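(* Let $n\ge 2$ and $A_n=\{a_1,\dots,a_n\}$. (1) Let $\theta: P_n\to B$ be a monoid homomorphism to a Boolean inverse monoid $B$ such that $\bigvee_{i=1}^{n}\theta(a_ia_i^{-1})=1$. Then $\theta$ is a cover-to-join map. (2) For every such $\theta$ there is a unique morphism of Boolean inverse monoids $\psi: C_n\to B$ such that $\psi\iota=\theta$, where $\iota:P_n\to C_n$ is the natural embedding.
   Context: Inverse semigroups: the natural partial order is $a\le b$ iff $a=ba^{-1}a$; $a\sim b$ (compatible) iff $a^{-1}b$ and $ab^{-1}$ are both idempotents. An inverse monoid is distributive if each pair of compatible elements has a join and multiplication distributes over such joins; it is Boolean if in addition its idempotents form a Boolean algebra. A morphism of distributive (in particular Boolean) inverse monoids is a monoid homomorphism mapping joins of compatible elements to joins. $A_n^{*}$ is the free monoid on $A_n$, with identity the empty string $\varepsilon$. For $x,y\in A_n^{*}$, $xy^{-1}$ denotes the bijection $yA_n^{*}\to xA_n^{*}$, $yu\mapsto xu$. The polycyclic inverse monoid $P_n$ consists of all the maps $xy^{-1}$ together with the empty partial function $0$, under composition of partial functions; its identity is $1=\varepsilon\varepsilon^{-1}$. A morphism $\theta:R_1\to R_2$ between right ideals of $A_n^{*}$ is a function with $\theta(rs)=\theta(r)s$ for all $r\in R_1,s\in A_n^{*}$. $D_n$ is the inverse monoid, under composition of partial functions, of all bijective morphisms between finitely generated right ideals $XA_n^{*}$ ($X$ finite, possibly empty) of $A_n^{*}$. Thus $P_n\subseteq D_n$. The Lenz congruence on an inverse semigroup with zero: $s\equiv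 t$ iff for each $0<x\le s$ there is a non-zero element below both $x$ and $t$, and for each $0<y\le t$ there is a non-zero element below both $y$ and $s$. $C_n=D_n/{\equiv}$, a Boolean inverse monoid (the Cuntz inverse monoid). The natural embedding $\iota:P_n\to C_n$ sends $s$ to its $\equiv$-class $[s]$. For elements $a_1',\dots,a_m'\le a$ of an inverse semigroup with zero ($m\ge1$), $\{a_1',\dots,a_m'\}$ is a (tight) cover of $a$ if $0<x\le a$ implies $x\wedge a_i'\ne0$ for some $i$ (these meets exist, since elements with a common upper bound are compatible). A homomorphism $\theta:S\to B$ to a Boolean inverse semigroup is a cover-to-join map if whenever $\{a_1',\dots,a_m'\}$ is a cover of $a$ we have $\theta(a)=\bigvee_{i=1}^{m}\theta(a_i')$. *)

(* Defs.v *)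
From HB Require Import structures.
From mathcomp Require Import all_boot all_order.
From mathcomp Require Import generic_quotient boolp classical_sets.

Set Implicit Arguments.
Unset Strict Implicit.
Unset Printing Implicit Defensive.

Import Monoid Algebra.
Local Open Scope classical_set_scope.
Local Open Scope quotient_scope.
Local Open Scope group_scope.

(* The axioms of [StarMonoid] (the inverse is an involution reversing products)
   hold in every inverse monoid, so requiring them restricts nothing. *)
HB.mixin Record StarMonoid_isInverse S of StarMonoid S := {
  mulgVKg : forall x : S, x * x^-1 * x = x;
  invg_uniq : forall x y : S, x * y * x = x -> y * x * y = y -> y = x^-1
}.

#[short(type="inverseMonoidType")]
HB.structure Definition InverseMonoid :=
  {S of StarMonoid_isInverse S & StarMonoid S}.

HB.factory Record StarMonoid_isCommInverse S of StarMonoid S := {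
  mulgVKg : forall x : S, x * x^-1 * x = x;
  mulgVC : forall x y : S, x * x^-1 * (y * y^-1) = y * y^-1 * (x * x^-1)
}.

HB.builders Context S of StarMonoid_isCommInverse S.

Let mulVgKV (x : S) : x^-1 * x * x^-1 = x^-1.
Proof. by have := mulgVKg x^-1; rewrite invgK. Qed.

Let idem_inv (e : S) : e * e = e -> e^-1 = e.
Proof.
move=> ee; have iee : e^-1 * e^-1 = e^-1 by rewrite -invgM ee.
have H : e = e^-1.
  rewrite -{1}(mulgVKg e) -{1}iee -!mulgA [e * (e^-1 * _)]mulgA.
  have := mulgVC e e^-1; rewrite invgK => ->.
  rewrite -mulgA [e * (e * _)]mulgA ee mulgA; exact: mulVgKV.
by rewrite -H.
Qed.

Let idem_comm (e f : S) : e * e = e -> f * f = f -> e * f = f * e.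
Proof.
move=> ee ff; have := mulgVC e f.
by rewrite (idem_inv ee) (idem_inv ff) ee ff.
Qed.

Fact invg_uniq (x y : S) : x * y * x = x -> y * x * y = y -> y = x^-1.
Proof.
move=> xyx yxy.
have i1 : x * y * (x * y) = x * y by rewrite mulgA xyx.
have i2 : x * x^-1 * (x * x^-1) = x * x^-1 by rewrite mulgA mulgVKg.
have i3 : y * x * (y * x) = y * x by rewrite mulgA yxy.
have i4 : x^-1 * x * (x^-1 * x) = x^-1 * x by rewrite mulgA mulVgKV.
have e1 : y = x^-1 * x * y.
  have -> : x^-1 * x * y = y * x * (x^-1 * x) * y.
    by rewrite (idem_comm i3 i4) -[in RHS]mulgA yxy.
  by rewrite mulgA -2!(mulgA y) mulgVKg yxy.
have e2 : x^-1 * x * y = x^-1 * (x * x^-1 * (x * y)).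
  by rewrite !mulgA mulVgKV.
by rewrite e1 e2 (idem_comm i2 i1) (mulgA (x * y)) xyx mulgA mulVgKV.
Qed.

HB.instance Definition _ := StarMonoid_isInverse.Build S mulgVKg invg_uniq.

HB.end.

Section NaturalOrder.
Variable S : inverseMonoidType.
Implicit Types (a b c d : S) (A : set S).

Definition idem a : Prop := a * a = a.
Definition natle a b : Prop := a = b * a^-1 * a.
Definition compatible a b : Prop := idem (a^-1 * b) /\ idem (a * b^-1).

Definition is_join A c : Prop :=
  (forall a, A a -> natle a c) /\
  (forall d, (forall a, A a -> natle a d) -> natle c d).

Definition is_meet a b c : Prop :=
  [/\ natle c a, natle c b & forall d, natle d a -> natle d b -> natle d c].

Lemma mulVgKV a : a^-1 * a * a^-1 = a^-1.
Proof. by have := mulgVKg a^-1; rewrite invgK. Qed.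

Lemma idem_dom a : idem (a^-1 * a).
Proof. by rewrite /idem mulgA mulVgKV. Qed.

Lemma idem_ran a : idem (a * a^-1).
Proof. by rewrite /idem mulgA mulgVKg. Qed.

Lemma idem1 : idem (1 : S).
Proof. exact: mul1g. Qed.

Lemma idem_inv a : idem a -> a^-1 = a.
Proof. by move=> aa; apply/esym/invg_uniq; rewrite !aa. Qed.

Lemma idem_comm a b : idem a -> idem b -> a * b = b * a.
Proof.
move=> aa bb.
have hM (e f : S) : idem e -> idem f -> idem (e * f).
  move=> ee ff; pose x := (e * f)^-1.
  have xE : f * x * e = x.
    apply: invg_uniq.
      rewrite -[RHS]mulgVKg -/x !mulgA -(mulgA e f f) ff.
      by rewrite -(mulgA _ e e) ee.
    rewrite !mulgA -(mulgA _ e e) ee -(mulgA _ f f) ff.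
    by rewrite -(mulgA (f * x) e f) -(mulgA f x) -(mulgA f) mulVgKV.
  have xx : idem x.
    by rewrite /idem -{1 2}xE !mulgA -(mulgA _ e f) -(mulgA f x) -(mulgA f) mulVgKV.
  have <- : x = e * f by rewrite -(invgK (e * f)) -/x (idem_inv xx).
  exact: xx.
have ab := hM _ _ aa bb; have ba := hM _ _ bb aa.
rewrite -(idem_inv ab); apply/esym/invg_uniq.
  by rewrite !mulgA -(mulgA _ b b) bb -(mulgA _ a a) aa -mulgA.
by rewrite !mulgA -(mulgA _ a a) aa -(mulgA _ b b) bb -mulgA.
Qed.

Lemma idemM a b : idem a -> idem b -> idem (a * b).
Proof.
move=> aa bb.
by rewrite /idem mulgA -(mulgA a) -(idem_comm aa bb) mulgA aa -mulgA bb.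
Qed.

Lemma idem_conj a b : idem a -> idem (b^-1 * a * b).
Proof.
move=> aa; rewrite /idem !mulgA -(mulgA _ b b^-1) -(mulgA _ (b * b^-1) a).
rewrite -(idem_comm aa (idem_ran b)) !mulgA -(mulgA _ a a) aa.
by rewrite -!mulgA (mulgA b) mulgVKg.
Qed.

Lemma natleP a b : natle a b <-> exists2 e, idem e & a = b * e.
Proof.
split=> [ab|[e ee ->]].
  by exists (a^-1 * a); [exact: idem_dom | rewrite mulgA].
rewrite /natle invgM (idem_inv ee) !mulgA.
rewrite -(mulgA b e) -(mulgA b) -(mulgA e) (idem_comm ee (idem_dom b)).
by rewrite !mulgA mulgVKg -[RHS]mulgA ee.
Qed.

Lemma mulg_idem a e : idem e -> exists2 f, idem f & a * e = f * a.
Proof.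
move=> ee; exists (a * e * a^-1).
  by have := idem_conj a^-1 ee; rewrite invgK.
by rewrite -!mulgA (idem_comm ee (idem_dom a)) !mulgA mulgVKg.
Qed.

Lemma idem_mulg a e : idem e -> exists2 f, idem f & e * a = a * f.
Proof.
move=> ee; exists (a^-1 * e * a); first exact: idem_conj.
by rewrite !mulgA (idem_comm (idem_ran a) ee) -!mulgA (mulgA a) mulgVKg.
Qed.

Lemma natle_refl a : natle a a.
Proof. by rewrite /natle mulgVKg. Qed.

Lemma natle_trans b a c : natle a b -> natle b c -> natle a c.
Proof.
move=> /natleP[e ee ->] /natleP[f ff ->]; apply/natleP.
by exists (f * e); [exact: idemM | rewrite mulgA].
Qed.

Lemma natle_anti a b : natle a b -> natle b a -> a = b.
Proof.
move=> /natleP[e ee ae] /natleP[f ff bf].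
have bE : b = b * e * f by rewrite -ae.
by rewrite ae {1}bE -!mulgA (idem_comm ff ee) (mulgA e) ee mulgA.
Qed.

Lemma natleM a b c d : natle a b -> natle c d -> natle (a * c) (b * d).
Proof.
move=> /natleP[e ee ->] /natleP[f ff ->]; apply/natleP.
have [g gg eg] := idem_mulg d ee.
exists (g * f); first exact: idemM.
by rewrite -!mulgA (mulgA e) eg !mulgA.
Qed.

Lemma natleV a b : natle a b -> natle a^-1 b^-1.
Proof.
move=> /natleP[e ee ->]; rewrite invgM (idem_inv ee).
by apply/natleP; apply: idem_mulg.
Qed.

Lemma natle1 a : natle a 1 <-> idem a.
Proof.
split=> [/natleP[e ee ->]|aa]; first by rewrite mul1g.
by apply/natleP; exists a; rewrite ?mul1g.
Qed.

Lemma is_join_uniq A c d : is_join A c -> is_join A d -> c = d.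
Proof. by move=> [h1 h2] [h3 h4]; apply: natle_anti; [apply: h2|apply: h4]. Qed.

Lemma natle_idem a b : idem a -> idem b -> natle a b <-> a * b = a.
Proof.
move=> aa bb; rewrite /natle (idem_inv aa) -mulgA aa (idem_comm aa bb).
by split=> /esym.
Qed.

End NaturalOrder.

HB.mixin Record hasZero S of Magma S := {
  zerog : S;
  mul0g : left_zero zerog (@mul S);
  mulg0 : right_zero zerog (@mul S)
}.

#[short(type="inverseMonoid0Type")]
HB.structure Definition InverseMonoid0 :=
  {S of hasZero S & InverseMonoid S}.

Local Notation "0" := (@zerog _) : group_scope.

HB.mixin Record InverseMonoid_isDistributive S of InverseMonoid S := {
  compatible_join : forall a b : S, compatible a b ->
    exists c : S, is_join [set a; b] c;
  mulg_joinr : forall a b c s : S, compatible a b -> is_join [set a; b] c ->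
    is_join [set s * a; s * b] (s * c);
  mulg_joinl : forall a b c s : S, compatible a b -> is_join [set a; b] c ->
    is_join [set a * s; b * s] (c * s)
}.

#[short(type="distrInverseMonoidType")]
HB.structure Definition DistrInverseMonoid :=
  {S of InverseMonoid_isDistributive S & InverseMonoid S}.

(* [f] is an isomorphism from a Boolean algebra [E] onto the poset of idempotents
   under the natural partial order. *)
Definition boolean_idempotents (S : inverseMonoidType) : Prop :=
  exists (d : Order.disp_t) (E : ctbDistrLatticeType d) (f : E -> S),
    [/\ injective f, range f = [set e | idem e] &
        forall x y : E, (x <= y)%O <-> natle (f x) (f y)].

HB.mixin Record DistrInverseMonoid_isBoolean S of DistrInverseMonoid S := {
  idem_boolean : boolean_idempotents S
}.

#[short(type="booleanInverseMonoidType")]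
HB.structure Definition BooleanInverseMonoid :=
  {S of DistrInverseMonoid_isBoolean S & DistrInverseMonoid S}.

(* Zero is not assumed to be preserved. *)
Definition boolean_morphism (S T : booleanInverseMonoidType) (f : S -> T) :=
  monoid_morphism f /\
  forall a b c : S, compatible a b -> is_join [set a; b] c ->
    is_join [set f a; f b] (f c).

Section Cover.
Variable S : inverseMonoid0Type.
Implicit Types (a s t x : S).

Definition is_cover a (m : nat) (c : 'I_m -> S) : Prop :=
  [/\ (0 < m)%N, (forall i, natle (c i) a) &
      forall x, x <> 0 -> natle x a ->
        exists i, exists2 z, is_meet x (c i) z & z <> 0].

Definition cover_to_join (B : booleanInverseMonoidType) (theta : S -> B) :=
  forall a m (c : 'I_m -> S), is_cover a c ->
    is_join (range (fun i => theta (c i))) (theta a).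

Definition lenz_below s t : Prop :=
  forall x, x <> 0 -> natle x s ->
    exists z, [/\ z <> 0, natle z x & natle z t].

Definition lenz s t : Prop := lenz_below s t /\ lenz_below t s.

End Cover.

Section LenzCongruence.
Variable S : inverseMonoid0Type.
Implicit Types (a s t x : S).

Lemma natle0 a : natle a 0 -> a = 0.
Proof. by move=> /natleP[e _ ->]; rewrite mul0g. Qed.

Lemma invg0 : 0^-1 = 0 :> S.
Proof. by rewrite -(mulVgKV 0) mulg0 mul0g. Qed.

Lemma lenz_refl : reflexive (fun s t => `[< lenz s t >]).
Proof.
by move=> s; apply/asboolP; split=> x x0 xs; exists x; split=> //; apply: natle_refl.
Qed.

Lemma lenz_sym : symmetric (fun s t => `[< lenz s t >]).
Proof. by move=> s t; apply/asboolP/asboolP => -[]. Qed.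

Lemma lenz_trans : transitive (fun s t => `[< lenz s t >]).
Proof.
have h s t u : lenz_below s t -> lenz_below t u -> lenz_below s u.
  move=> st tu x x0 /(st x x0)[z [z0 zx /(tu z z0)[w [w0 wz wu]]]].
  by exists w; split=> //; apply: natle_trans zx.
move=> t s u /asboolP[st ts] /asboolP[tu ut].
by apply/asboolP; split; apply: h; eassumption.
Qed.

Canonical lenz_equiv := EquivRel _ lenz_refl lenz_sym lenz_trans.

Lemma lenz_belowV s t : lenz_below s t -> lenz_below s^-1 t^-1.
Proof.
move=> st x x0 /natleV; rewrite invgK => xs.
have x0' : x^-1 <> 0 by move=> h; apply: x0; rewrite -(invgK x) h invg0.
have [z [z0 zx zt]] := st _ x0' xs; exists z^-1; split.
- by move=> h; apply: z0; rewrite -(invgK z) h invg0.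
- by rewrite -(invgK x); apply: natleV.
- exact: natleV.
Qed.

Lemma lenz_belowM a s t : lenz_below s t -> lenz_below (a * s) (a * t).
Proof.
move=> st x x0 /natleP[e ee xE].
have aax : a * a^-1 * x = x by rewrite xE !mulgA mulgVKg.
have ys : natle (a^-1 * x) s.
  have -> : a^-1 * x = a^-1 * a * (s * e) by rewrite xE !mulgA.
  apply: (@natle_trans _ (1 * s)); last by rewrite mul1g; apply: natle_refl.
  by apply: natleM; [apply/natle1/idem_dom | apply/natleP; exists e].
have y0 : a^-1 * x <> 0 by move=> h; apply: x0; rewrite -aax -mulgA h mulg0.
have [z [z0 zy zt]] := st _ y0 ys.
exists (a * z); split.
- move=> az; apply: z0.
  have [f ff zE] := (natleP z (a^-1 * x)).1 zy.
  have <- : a^-1 * (a * z) = z by rewrite zE !mulgA mulVgKV.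
  by rewrite az mulg0.
- by rewrite -aax -mulgA; apply: natleM => //; apply: natle_refl.
- by apply: natleM => //; apply: natle_refl.
Qed.

Lemma lenzV s t : lenz s t -> lenz s^-1 t^-1.
Proof. by case; split; apply: lenz_belowV. Qed.

Lemma lenzMl a s t : lenz s t -> lenz (a * s) (a * t).
Proof. by case; split; apply: lenz_belowM. Qed.

Lemma lenzMr a s t : lenz s t -> lenz (s * a) (t * a).
Proof. by move=> /lenzV/(lenzMl a^-1)/lenzV; rewrite !invgM !invgK. Qed.

Definition lenz_quot := {eq_quot lenz_equiv}.
HB.instance Definition _ : EqQuotient _ lenz_equiv lenz_quot :=
  EqQuotient.on lenz_quot.
HB.instance Definition _ := Choice.on lenz_quot.

Lemma lenz_quotP s t : \pi_lenz_quot s = \pi_lenz_quot t <-> lenz s t.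
Proof.
by split=> [/eqmodP/asboolP|st] //; apply/eqmodP/asboolP.
Qed.

Implicit Types p q r : lenz_quot.

Definition lenz_mul p q : lenz_quot := \pi_lenz_quot (repr p * repr q).
Definition lenz_inv p : lenz_quot := \pi_lenz_quot (repr p)^-1.
Definition lenz_one : lenz_quot := \pi_lenz_quot 1.

Lemma lenz_repr s : lenz (repr (\pi_lenz_quot s)) s.
Proof. by apply/lenz_quotP; rewrite reprK. Qed.

Lemma lenz_mulE s t :
  lenz_mul (\pi_lenz_quot s) (\pi_lenz_quot t) = \pi_lenz_quot (s * t).
Proof.
transitivity (\pi_lenz_quot (s * repr (\pi_lenz_quot t))).
  exact/lenz_quotP/lenzMr/lenz_repr.
exact/lenz_quotP/lenzMl/lenz_repr.
Qed.

Lemma lenz_invE s : lenz_inv (\pi_lenz_quot s) = \pi_lenz_quot s^-1.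
Proof. exact/lenz_quotP/lenzV/lenz_repr. Qed.

Let piP (P : lenz_quot -> Prop) : (forall s, P (\pi_lenz_quot s)) -> forall p, P p.
Proof. by move=> h p; rewrite -(reprK p). Qed.

Fact lenz_mulA : associative lenz_mul.
Proof.
elim/piP=> s; elim/piP=> t; elim/piP=> u.
by rewrite !lenz_mulE mulgA.
Qed.

Fact lenz_mul1 : left_id lenz_one lenz_mul.
Proof. by elim/piP=> s; rewrite lenz_mulE mul1g. Qed.

Fact lenz_invK : involutive lenz_inv.
Proof. by elim/piP=> s; rewrite !lenz_invE invgK. Qed.

Fact lenz_invM : {morph lenz_inv : p q / lenz_mul p q >-> lenz_mul q p}.
Proof.
by elim/piP=> s; elim/piP=> t; rewrite lenz_mulE !lenz_invE lenz_mulE invgM.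
Qed.

HB.instance Definition _ :=
  isStarMonoid.Build lenz_quot lenz_mulA lenz_mul1 lenz_invK lenz_invM.

Lemma lenz_piM s t : \pi_lenz_quot (s * t) = \pi_lenz_quot s * \pi_lenz_quot t.
Proof. by rewrite -lenz_mulE. Qed.

Lemma lenz_piV s : \pi_lenz_quot s^-1 = (\pi_lenz_quot s)^-1.
Proof. by rewrite -lenz_invE. Qed.

Fact lenz_mulgVKg p : p * p^-1 * p = p.
Proof. by elim/piP: p => s; rewrite -lenz_piV -!lenz_piM mulgVKg. Qed.

Fact lenz_mulgVC p q : p * p^-1 * (q * q^-1) = q * q^-1 * (p * p^-1).
Proof.
elim/piP: p => s; elim/piP: q => t.
rewrite -!lenz_piV -!lenz_piM (idem_comm (idem_ran s)) //; exact: idem_ran.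
Qed.

HB.instance Definition _ :=
  StarMonoid_isCommInverse.Build lenz_quot lenz_mulgVKg lenz_mulgVC.

End LenzCongruence.

Section IdempotentLattice.
Variable S : distrInverseMonoidType.

Definition complemented (z : S) : Prop :=
  [/\ idem z, forall e : S, idem e -> natle z e &
      forall e : S, idem e -> exists f : S,
        [/\ idem f, e * f = z & is_join [set e; f] 1]].

Variables (z : S) (zc : complemented z).

Definition idem_lattice of complemented z := {e : S | `[< idem e >]}.
Local Notation E := (idem_lattice zc).
HB.instance Definition _ := [isSub of E for @sval _ _].
HB.instance Definition _ := [Choice of E by <:].

Let idemE (e : E) : idem (val e). Proof. exact/asboolP/(valP e). Qed.

Let compat (e f : S) : idem e -> idem f -> compatible e f.
Proof.
by move=> ee ff; rewrite /compatible !(idem_inv ee) (idem_inv ff); split; apply: idemM.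
Qed.

Let joinP (e f : E) : exists g : E, is_join [set val e; val f] (val g).
Proof.
have [c jc] := compatible_join _ _ (compat (idemE e) (idemE f)).
have cc : idem c.
  apply/natle1/jc.2 => _ [->|->]; apply/natle1; exact: idemE.
by exists (Sub c (asboolT cc)).
Qed.

Let bj (e f : E) : E := projT1 (cid (joinP e f)).
Let bjP e f : is_join [set val e; val f] (val (bj e f)).
Proof. exact: (projT2 (cid (joinP e f))). Qed.

Let bm (e f : E) : E := Sub (val e * val f) (asboolT (idemM (idemE e) (idemE f))).

Let complP (e : E) : exists f : E,
  val e * val f = z /\ is_join [set val e; val f] 1.
Proof.
have [_ _ h] := zc; have [f [ff efz j]] := h _ (idemE e).
by exists (Sub f (asboolT ff)).
Qed.

Let bc (e : E) : E := projT1 (cid (complP e)).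
Let bb : E := Sub z (asboolT (let: And3 h _ _ := zc in h)).
Let bt : E := Sub 1 (asboolT (idem1 S)).

Let ble (e f : E) := val e * val f == val e.
Let bleP e f : reflect (natle (val e) (val f)) (ble e f).
Proof. by apply: (iffP eqP) => /(natle_idem (idemE e) (idemE f)). Qed.

Let bmC : commutative bm.
Proof. by move=> e f; apply: val_inj => /=; apply: idem_comm; apply: idemE. Qed.

Let bmA : associative bm.
Proof. by move=> e f g; apply: val_inj => /=; rewrite mulgA. Qed.

Let bjC : commutative bj.
Proof.
move=> e f; apply: val_inj; apply: is_join_uniq (bjP e f) _.
by have := bjP f e; rewrite setUC.
Qed.

Let ubl e f : natle (val e) (val (bj e f)).
Proof. by have [h _] := bjP e f; apply: h; left. Qed.
Let ubr e f : natle (val f) (val (bj e f)).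
Proof. by have [h _] := bjP e f; apply: h; right. Qed.
Let lub e f c : natle (val e) c -> natle (val f) c -> natle (val (bj e f)) c.
Proof. by move=> h1 h2; have [_ h] := bjP e f; apply: h => _ [->|->]. Qed.

Let bjA : associative bj.
Proof.
move=> e f g; apply: val_inj; apply: natle_anti.
  apply: lub; first exact: natle_trans (ubl e f) (ubl _ _).
  apply: lub (ubr _ _); exact: natle_trans (ubr e f) (ubl _ _).
apply: lub; last exact: natle_trans (ubr f g) (ubr _ _).
apply: lub (ubl _ _) _; exact: natle_trans (ubl f g) (ubr _ _).
Qed.

Let bjKI (f e : E) : bm e (bj e f) = e.
Proof.
by apply: val_inj; apply/(natle_idem (idemE e) (idemE _))/ubl.
Qed.

Let bmKU (f e : E) : bj e (bm e f) = e.
Proof.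
apply: val_inj; apply: natle_anti; last exact: ubl.
apply: lub; first exact: natle_refl.
by apply/natleP; exists (val f); first exact: idemE.
Qed.

Let bmUl : left_distributive bm bj.
Proof.
move=> e f g; apply: val_inj.
apply: is_join_uniq (bjP (bm e g) (bm f g)).
exact: mulg_joinl _ _ _ _ (compat (idemE e) (idemE f)) (bjP e f).
Qed.

Let bmm : idempotent_op bm.
Proof. by move=> e; apply: val_inj; apply: idemE. Qed.

HB.instance Definition _ := @Order.isMeetJoinDistrLattice.Build
  (Order.Disp tt tt) E ble (fun e f => (f != e) && ble e f) bm bj
  (fun e f => erefl) (fun e f => erefl) bmC bjC bmA bjA bjKI bmKU bmUl bmm.


Let ble0 e : (bb <= e)%O.
Proof. by apply/bleP; have [_ h _] := zc; apply/h/idemE. Qed.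

Let ble1 e : (e <= bt)%O.
Proof. by apply/bleP/natle1/idemE. Qed.

HB.instance Definition _ := Order.hasBottom.Build _ E ble0.
HB.instance Definition _ := Order.hasTop.Build _ E ble1.

Let joinxC (e : E) : (e `|` bc e = \top)%O.
Proof.
by apply: val_inj; apply: is_join_uniq (bjP _ _) (projT2 (cid (complP e))).2.
Qed.

Let meetxC (e : E) : (e `&` bc e = \bot)%O.
Proof. by apply: val_inj; have [h _] := projT2 (cid (complP e)). Qed.

HB.instance Definition _ :=
  Order.TBDistrLattice_hasComplement.Build _ E joinxC meetxC.

Lemma complemented_boolean : boolean_idempotents S.
Proof.
exists (Order.Disp tt tt), E, (@sval _ _); split.
- exact: val_inj.
- apply/seteqP; split=> [_ [e _ <-]|e ee]; first exact: idemE.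
  by exists (exist _ e (asboolT ee)).
- by move=> e f; split=> /bleP.
Qed.

End IdempotentLattice.

Section FreeMonoid.
Variable n : nat.

Definition word := seq 'I_n.
Definition pfun := word -> option word.
Implicit Types (f g h : pfun) (u v w : word) (X Y : seq word).

Definition right_ideal X : set word :=
  [set w | exists2 x, x \in X & exists u, w = x ++ u].

Definition pdom f : set word := [set w | exists v, f w = Some v].
Definition pcod f : set word := [set v | exists w, f w = Some v].

Definition fg_ideal (R : set word) : Prop := exists X, R = right_ideal X.

Definition bij_morphism f : Prop :=
  [/\ fg_ideal (pdom f), fg_ideal (pcod f),
      (forall v w u, f v = Some u -> f w = Some u -> v = w) &
      (forall r r' s, f r = Some r' -> f (r ++ s) = Some (r' ++ s))].

(* [pcomp f g] applies [g] first. *)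
Definition pcomp f g : pfun := fun w => obind f (g w).
Definition pinv f : pfun := fun v =>
  if pselect (exists w, f w = Some v) is left ex then Some (projT1 (cid ex))
  else None.
Definition pid : pfun := fun w => Some w.
Definition pempty : pfun := fun _ => None.

(* [pmono x y] is the partial map [x y^-1], sending [y u] to [x u]. *)
Definition pmono (x y : word) : pfun := fun w =>
  if prefix y w then Some (x ++ drop (size y) w) else None.

Lemma pcompP f g w v :
  pcomp f g w = Some v <-> exists2 u, g w = Some u & f u = Some v.
Proof.
rewrite /pcomp; split; last by move=> [u -> /= ->].
by case: (g w) => [u|] //= fu; exists u.
Qed.

Lemma pfunP f g : (forall w v, f w = Some v <-> g w = Some v) -> f = g.
Proof.
move=> fg; apply/funext => w; case fw: (f w) => [v|].
  by apply/esym/fg.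
by case gw: (g w) => [v|] //; move/fg: gw; rewrite fw.
Qed.

Lemma pinvP f v w : bij_morphism f -> pinv f v = Some w <-> f w = Some v.
Proof.
move=> [_ _ inj _]; rewrite /pinv; case: pselect => [ex|nex].
  have fv := projT2 (cid ex); split=> [[<-] //|fw].
  by congr Some; apply: inj fv fw.
by split=> // fw; case: nex; exists w.
Qed.

Lemma pmonoP x y w v :
  pmono x y w = Some v <-> exists2 u, w = y ++ u & v = x ++ u.
Proof.
rewrite /pmono; split.
  by case: ifP => // /prefixP[u ->] [<-]; exists u; rewrite ?drop_size_cat.
by move=> [u -> ->]; rewrite prefix_prefix drop_size_cat.
Qed.

Lemma right_ideal1 x : right_ideal [:: x] = [set w | exists u, w = x ++ u].
Proof.
apply/seteqP; split=> [w [y]|w [u ->]]; first by rewrite inE => /eqP ->.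
by exists x; [rewrite inE | exists u].
Qed.

Lemma cat_prefix (x y u v : word) :
  x ++ u = y ++ v -> (exists t, y = x ++ t) \/ (exists t, x = y ++ t).
Proof.
elim: x y u v => [|a x IH] [|b y] u v; try by [left; eexists|right; eexists].
by move=> [-> /IH[[t ->]|[t ->]]]; [left|right]; exists t.
Qed.

Lemma fg_idealI (R T : set word) :
  fg_ideal R -> fg_ideal T -> fg_ideal (R `&` T).
Proof.
move=> [X ->] [Y ->].
exists ([seq x <- X | `[< right_ideal Y x >]] ++
        [seq y <- Y | `[< right_ideal X y >]]).
apply/seteqP; split=> [w [[x xX [u wx]] [y yY [v wy]]]|w].
  have [[t yE]|[t xE]] : (exists t, y = x ++ t) \/ (exists t, x = y ++ t).
  - by apply: (@cat_prefix _ _ u v); rewrite -wx -wy.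
  - exists y; last by exists v.
    rewrite mem_cat !mem_filter yY andbT; apply/orP; right.
    by apply/asboolP; exists x => //; exists t.
  - exists x; last by exists u.
    rewrite mem_cat !mem_filter xX andbT; apply/orP; left.
    by apply/asboolP; exists y => //; exists t.
move=> [x]; rewrite mem_cat !mem_filter => /orP[] /andP[/asboolP[y yin [v ->]]].
  by move=> xX [u ->]; split; [exists (y ++ v) => //; exists u|
                               exists y => //; exists (v ++ u); rewrite catA].
by move=> xX [u ->]; split; [exists y => //; exists (v ++ u); rewrite catA|
                             exists (y ++ v) => //; exists u].
Qed.

Lemma fg_idealU (R T : set word) :
  fg_ideal R -> fg_ideal T -> fg_ideal (R `|` T).
Proof.
move=> [X ->] [Y ->]; exists (X ++ Y); apply/seteqP; split=> w.
  by move=> [] [x xX wx]; exists x => //; rewrite mem_cat xX ?orbT.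
move=> [x]; rewrite mem_cat => /orP[] xX wx; [left|right]; by exists x.
Qed.

Lemma fg_preim g (R : set word) : bij_morphism g -> fg_ideal R ->
  fg_ideal [set w | exists2 v, g w = Some v & R v].
Proof.
move=> bg fR; have [_ cg inj mor] := bg.
have [Z ZE] := fg_idealI cg fR.
exists (pmap (pinv g) Z); apply/seteqP; split=> [w [v gw Rv]|w [x]].
  have : (pcod g `&` R) v by split=> //; exists w.
  rewrite ZE => -[z zZ [u vE]].
  have : (pcod g `&` R) z by rewrite ZE; exists z => //; exists [::]; rewrite cats0.
  move=> [[w0 gw0] _]; exists w0.
    by rewrite mem_pmap; apply/mapP; exists z => //; apply/esym/pinvP.
  by exists u; apply: inj gw _; rewrite vE; apply: mor.
rewrite mem_pmap => /mapP[z zZ /esym/pinvP-/(_ bg) gx] [u ->].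
exists (z ++ u); first exact: mor.
have : (pcod g `&` R) (z ++ u) by rewrite ZE; exists z => //; exists u.
by case.
Qed.

Lemma bij_pinv f : bij_morphism f -> bij_morphism (pinv f).
Proof.
move=> bf; have [df cf inj mor] := bf.
have ivP v w : pinv f v = Some w <-> f w = Some v by apply: pinvP.
split.
- have -> // : pdom (pinv f) = pcod f.
  by apply/seteqP; split=> w [v h]; exists v => //; exact/ivP.
- have -> // : pcod (pinv f) = pdom f.
  by apply/seteqP; split=> w [v h]; exists v => //; exact/ivP.
- by move=> v w u /ivP h1 /ivP; rewrite h1 => -[].
- by move=> r r' s /ivP h; apply/ivP; apply: mor.
Qed.

Lemma bij_pcomp f g :
  bij_morphism f -> bij_morphism g -> bij_morphism (pcomp f g).
Proof.
move=> bf bg; have [df cf injf morf] := bf; have [dg cg injg morg] := bg.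
split.
- have -> : pdom (pcomp f g) = [set w | exists2 v, g w = Some v & pdom f v].
    apply/seteqP; split=> [w [v /pcompP[u gw fu]]|w [v gw [u fv]]].
      by exists u => //; exists v.
    by exists u; apply/pcompP; exists v.
  exact: fg_preim.
- have -> : pcod (pcomp f g) =
      [set w | exists2 v, pinv f w = Some v & pcod g v].
    apply/seteqP; split=> [v [w /pcompP[u gw fu]]|v [u /pinvP-/(_ bf) fu [w gw]]].
      by exists u; [apply/pinvP | exists w].
    by exists w; apply/pcompP; exists u.
  by apply: fg_preim => //; apply: bij_pinv.
- move=> v w u /pcompP[v' gv fv] /pcompP[w' gw fw].
  by apply: injg gv _; rewrite (injf _ _ _ fv fw).
- move=> r r' s /pcompP[u gr fu]; apply/pcompP.
  by exists (u ++ s); [exact: morg | exact: morf].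
Qed.

Definition pidon X : pfun := fun w =>
  if `[< right_ideal X w >] then Some w else None.

Lemma pidonP X w v : pidon X w = Some v <-> right_ideal X w /\ v = w.
Proof.
rewrite /pidon; case: asboolP => h; first by split=> [[<-]|[_ ->]].
by split=> // -[].
Qed.

Lemma bij_pidon X : bij_morphism (pidon X).
Proof.
split.
- exists X; apply/seteqP; split=> [w [v /pidonP[]]|w h] //.
  by exists w; apply/pidonP.
- exists X; apply/seteqP; split=> [w [v /pidonP[h ->]]|w h] //.
  by exists w; apply/pidonP.
- by move=> v w u /pidonP[_ ->] /pidonP[].
- move=> r r' s /pidonP[[x xX [u ->]] ->]; apply/pidonP; split=> //.
  by exists x => //; exists (u ++ s); rewrite catA.
Qed.

Lemma bij_pid : bij_morphism pid.
Proof.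
have -> : pid = pidon [:: [::]].
  apply: pfunP => w v; rewrite pidonP /pid; split=> [[<-]|[_ ->]] //.
  by split=> //; exists [::] => //; exists w.
exact: bij_pidon.
Qed.

Lemma bij_pempty : bij_morphism pempty.
Proof.
have -> : pempty = pidon [::].
  by apply: pfunP => w v; rewrite pidonP; split=> // -[[]].
exact: bij_pidon.
Qed.

Lemma bij_pmono x y : bij_morphism (pmono x y).
Proof.
split.
- exists [:: y]; rewrite right_ideal1; apply/seteqP; split=> w.
    by move=> [v /pmonoP[u -> _]]; exists u.
  by move=> [u ->]; exists (x ++ u); apply/pmonoP; exists u.
- exists [:: x]; rewrite right_ideal1; apply/seteqP; split=> w.
    by move=> [v /pmonoP[u _ ->]]; exists u.
  by move=> [u ->]; exists (y ++ u); apply/pmonoP; exists u.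
- move=> v w u /pmonoP[u1 -> ->] /pmonoP[u2 -> /eqP].
  by rewrite eqseq_cat // eqxx => /eqP ->.
- move=> r r' s /pmonoP[u -> ->]; apply/pmonoP.
  by exists (u ++ s); rewrite catA.
Qed.

Record Dn := MkDn { dfun :> word -> option word; dfunP : `[< bij_morphism dfun >] }.
HB.instance Definition _ := [isSub for dfun].
HB.instance Definition _ := [Choice of Dn by <:].
Implicit Types a b c : Dn.

Lemma dbij a : bij_morphism a.
Proof. exact/asboolP/dfunP. Qed.

Lemma DnP a b : (forall w v, a w = Some v <-> b w = Some v) -> a = b.
Proof. by move=> ab; apply: val_inj; apply: pfunP. Qed.

Definition Dmul a b : Dn := MkDn (asboolT (bij_pcomp (dbij a) (dbij b))).
Definition Dinv a : Dn := MkDn (asboolT (bij_pinv (dbij a))).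
Definition Done : Dn := MkDn (asboolT bij_pid).
Definition Dzero : Dn := MkDn (asboolT bij_pempty).
Definition Dmono x y : Dn := MkDn (asboolT (bij_pmono x y)).
Definition Didon X : Dn := MkDn (asboolT (bij_pidon X)).

Lemma DmulP a b w v :
  Dmul a b w = Some v <-> exists2 u, b w = Some u & a u = Some v.
Proof. exact: pcompP. Qed.

Lemma DinvP a w v : Dinv a w = Some v <-> a v = Some w.
Proof. exact/pinvP/dbij. Qed.

Fact DmulA : associative Dmul.
Proof.
move=> a b c; apply: DnP => w v; split=> /DmulP[u].
  by move=> /DmulP[t ct bt] au; apply/DmulP; exists t => //; apply/DmulP; exists u.
by move=> cw /DmulP[t bu at']; apply/DmulP; exists t => //; apply/DmulP; exists u.
Qed.

Fact Dmul1 : left_id Done Dmul.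
Proof.
move=> a; apply: DnP => w v; split=> [/DmulP[u au [<-]]|aw] //.
by apply/DmulP; exists v.
Qed.

Fact DinvK : involutive Dinv.
Proof. by move=> a; apply: DnP => w v; split=> [/DinvP/DinvP|?] //; apply/DinvP/DinvP. Qed.

Fact DinvM : {morph Dinv : a b / Dmul a b >-> Dmul b a}.
Proof.
move=> a b; apply: DnP => w v; split.
  move=> /DinvP/DmulP[u bv au]; apply/DmulP.
  by exists u; apply/DinvP.
move=> /DmulP[u /DinvP au /DinvP bu]; apply/DinvP/DmulP.
by exists u.
Qed.

HB.instance Definition _ := isStarMonoid.Build Dn DmulA Dmul1 DinvK DinvM.

Lemma Dn_mulP a b w v :
  (a * b) w = Some v <-> exists2 u, b w = Some u & a u = Some v.
Proof. exact: DmulP. Qed.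

Lemma Dn_invP a w v : a^-1 w = Some v <-> a v = Some w.
Proof. exact: DinvP. Qed.

Lemma D_inj a v w u : a v = Some u -> a w = Some u -> v = w.
Proof. by have [_ _ inj _] := dbij a; apply: inj. Qed.

Lemma D_mor a r r' s : a r = Some r' -> a (r ++ s) = Some (r' ++ s).
Proof. by have [_ _ _ mor] := dbij a; apply: mor. Qed.

Lemma Dn_domP a w v : (a^-1 * a) w = Some v <-> pdom a w /\ v = w.
Proof.
split=> [/Dn_mulP[u aw /Dn_invP av]|[[u aw] ->]].
  by split; [exists u | exact: D_inj av aw].
by apply/Dn_mulP; exists u => //; apply/Dn_invP.
Qed.

Fact Dn_mulgVKg a : a * a^-1 * a = a.
Proof.
apply: DnP => w v; rewrite -mulgA; split.
  by move=> /Dn_mulP[u /Dn_domP[_ ->]].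
by move=> aw; apply/Dn_mulP; exists w => //; apply/Dn_domP; split=> //; exists v.
Qed.

Fact Dn_mulgVC a b : a * a^-1 * (b * b^-1) = b * b^-1 * (a * a^-1).
Proof.
wlog suff h : a b / forall w v, (a * a^-1 * (b * b^-1)) w = Some v ->
    (b * b^-1 * (a * a^-1)) w = Some v.
  by apply: DnP => w v; split; apply: h.
move=> w v /Dn_mulP[u].
rewrite -{1}(invgK b) -{1}(invgK a) => /Dn_domP[bw ->] /Dn_domP[aw ->].
apply/Dn_mulP; exists w.
  by rewrite -{1}(invgK a); apply/Dn_domP.
by rewrite -{1}(invgK b); apply/Dn_domP.
Qed.

HB.instance Definition _ :=
  StarMonoid_isCommInverse.Build Dn Dn_mulgVKg Dn_mulgVC.

Fact Dmul0 : left_zero Dzero (@mul Dn).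
Proof. by move=> a; apply: DnP => w v; split=> // /Dn_mulP[]. Qed.

Fact Dmul0r : right_zero Dzero (@mul Dn).
Proof. by move=> a; apply: DnP => w v; split=> // /Dn_mulP[]. Qed.

HB.instance Definition _ := hasZero.Build Dn Dmul0 Dmul0r.

Definition in_Pn a : Prop := a = 0 \/ exists x y, a = Dmono x y.

Record Pn := MkPn { pn_val :> Dn; pn_valP : `[< in_Pn pn_val >] }.
HB.instance Definition _ := [isSub for pn_val].
HB.instance Definition _ := [Choice of Pn by <:].
Implicit Types p q r : Pn.

Lemma in_Pn_mul a b : in_Pn a -> in_Pn b -> in_Pn (a * b).
Proof.
move=> [->|[x [y ->]]]; first by left; rewrite mul0g.
move=> [->|[z [t ->]]]; first by left; rewrite mulg0.
case: (pselect (exists u, z = y ++ u)) => [[u zE]|nz].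
  right; exists (x ++ u), t; apply: DnP => w v; split.
    move=> /Dn_mulP[s /pmonoP[u1 -> ->] /pmonoP[u2]].
    rewrite zE -catA => /eqP; rewrite eqseq_cat // eqxx /= => /eqP <- ->.
    by apply/pmonoP; exists u1; rewrite ?catA.
  move=> /pmonoP[u1 -> ->]; apply/Dn_mulP; exists (z ++ u1).
    by apply/pmonoP; exists u1.
  by apply/pmonoP; exists (u ++ u1); rewrite ?zE catA.
case: (pselect (exists u, y = z ++ u)) => [[u yE]|ny].
  right; exists x, (t ++ u); apply: DnP => w v; split.
    move=> /Dn_mulP[s /pmonoP[u1 -> ->] /pmonoP[u2]].
    rewrite yE -catA => /eqP; rewrite eqseq_cat // eqxx /= => /eqP -> ->.
    by apply/pmonoP; exists u2; rewrite ?catA.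
  move=> /pmonoP[u1 -> ->]; apply/Dn_mulP; exists (y ++ u1).
    by apply/pmonoP; exists (u ++ u1); rewrite ?yE catA.
  by apply/pmonoP; exists u1.
left; apply: DnP => w v; split=> //.
move=> /Dn_mulP[s /pmonoP[u1 _ ->] /pmonoP[u2 /cat_prefix[]]] //.
Qed.

Lemma in_Pn_inv a : in_Pn a -> in_Pn a^-1.
Proof.
move=> [->|[x [y ->]]]; [left; exact: invg0|right; exists y, x].
apply: DnP => w v; split=> [/Dn_invP/pmonoP[u -> ->]|/pmonoP[u -> ->]].
  by apply/pmonoP; exists u.
by apply/Dn_invP/pmonoP; exists u.
Qed.

Lemma in_Pn1 : in_Pn 1.
Proof.
right; exists [::], [::]; apply: DnP => w v.
by split=> [[<-]|/pmonoP[u -> ->]] //; apply/pmonoP; exists w.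
Qed.

Let pP p : in_Pn p. Proof. exact/asboolP/pn_valP. Qed.

Definition Pmul p q : Pn := MkPn (asboolT (in_Pn_mul (pP p) (pP q))).
Definition Pinv p : Pn := MkPn (asboolT (in_Pn_inv (pP p))).
Definition Pone : Pn := MkPn (asboolT in_Pn1).
Definition Pzero : Pn := MkPn (asboolT (or_introl erefl : in_Pn 0)).

Fact in_Pn_mono x y : in_Pn (Dmono x y).
Proof. by right; exists x, y. Qed.

Definition Pmono x y : Pn := MkPn (asboolT (in_Pn_mono x y)).

Fact PmulA : associative Pmul.
Proof. by move=> p q r; apply: val_inj; apply: mulgA. Qed.
Fact Pmul1 : left_id Pone Pmul.
Proof. by move=> p; apply: val_inj; apply: mul1g. Qed.
Fact PinvK : involutive Pinv.
Proof. by move=> p; apply: val_inj; apply: invgK. Qed.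
Fact PinvM : {morph Pinv : p q / Pmul p q >-> Pmul q p}.
Proof. by move=> p q; apply: val_inj; apply: invgM. Qed.

HB.instance Definition _ := isStarMonoid.Build Pn PmulA Pmul1 PinvK PinvM.

Fact Pn_mulgVKg p : p * p^-1 * p = p.
Proof. by apply: val_inj; apply: (@mulgVKg Dn). Qed.
Fact Pn_mulgVC p q : p * p^-1 * (q * q^-1) = q * q^-1 * (p * p^-1).
Proof. by apply: val_inj; apply: Dn_mulgVC. Qed.

HB.instance Definition _ :=
  StarMonoid_isCommInverse.Build Pn Pn_mulgVKg Pn_mulgVC.

Fact Pmul0 : left_zero Pzero (@mul Pn).
Proof. by move=> p; apply: val_inj; apply: mul0g. Qed.
Fact Pmul0r : right_zero Pzero (@mul Pn).
Proof. by move=> p; apply: val_inj; apply: mulg0. Qed.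

HB.instance Definition _ := hasZero.Build Pn Pmul0 Pmul0r.

Definition Cn := lenz_quot Dn.
HB.instance Definition _ := InverseMonoid.on Cn.

(* [embC] restricts this projection to the polycyclic monoid [Pn]. *)
Definition pi_Cn (a : Dn) : Cn := \pi_(lenz_quot Dn) a.

Lemma pi_CnM a b : pi_Cn (a * b) = pi_Cn a * pi_Cn b.
Proof. exact: lenz_piM. Qed.
Lemma pi_CnV a : pi_Cn a^-1 = (pi_Cn a)^-1.
Proof. exact: lenz_piV. Qed.
Lemma pi_Cn_ind (P : Cn -> Prop) : (forall a, P (pi_Cn a)) -> forall x, P x.
Proof. by move=> h x; rewrite -(reprK (x : lenz_quot Dn)); apply: h. Qed.

Lemma natleD a b : natle a b <-> forall w v, a w = Some v -> b w = Some v.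
Proof.
rewrite /natle -mulgA; split=> [ab w v|ab].
  by rewrite {1}ab => /Dn_mulP[u] /Dn_domP[_ ->].
apply: DnP => w v; split=> [aw|/Dn_mulP[u /Dn_domP[[t aw] ->]] bw].
  apply/Dn_mulP; exists w; last exact: ab.
  by apply/Dn_domP; split=> //; exists v.
by move: (ab _ _ aw); rewrite bw aw.
Qed.

Lemma Dn_neq0 a : a <> 0 <-> exists w v, a w = Some v.
Proof.
split=> [a0|[w [v aw]] a0]; last by move: aw; rewrite a0.
apply: contrapT => h; apply: a0; apply: DnP => w v; split=> // aw.
by case: h; exists w, v.
Qed.

Lemma lenz_belowD a b : lenz_below a b <->
  forall w v, a w = Some v -> exists u, b (w ++ u) = Some (v ++ u).
Proof.
split=> ab.
  move=> w v aw.
  have x0 : Dmono v w <> 0.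
    by apply/Dn_neq0; exists w, v; apply/pmonoP; exists [::]; rewrite ?cats0.
  have xa : natle (Dmono v w) a.
    by apply/natleD => _ _ /pmonoP[u -> ->]; apply: D_mor.
  have [z [/Dn_neq0[s [t zs]] /natleD zx /natleD zb]] := ab _ x0 xa.
  have /pmonoP[u sE tE] := zx _ _ zs.
  by exists u; rewrite -sE -tE; apply: zb.
move=> x /Dn_neq0[w [v xw]] /natleD xa.
have [u bu] := ab _ _ (xa _ _ xw).
exists (Dmono (v ++ u) (w ++ u)); split.
- apply/Dn_neq0; exists (w ++ u), (v ++ u); apply/pmonoP.
  by exists [::]; rewrite cats0.
- apply/natleD => _ _ /pmonoP[t -> ->]; rewrite -!catA; exact: D_mor.
- by apply/natleD => _ _ /pmonoP[t -> ->]; apply: D_mor.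
Qed.

Lemma pi_CnP a b : pi_Cn a = pi_Cn b <-> lenz a b.
Proof. exact: lenz_quotP. Qed.

Lemma natleC a b : natle (pi_Cn a) (pi_Cn b) <->
  forall w v, a w = Some v -> exists u, b (w ++ u) = Some (v ++ u).
Proof.
have -> : natle (pi_Cn a) (pi_Cn b) = (pi_Cn a = pi_Cn (b * (a^-1 * a))).
  by rewrite /natle (mulgA b) (pi_CnM (b * _) a) (pi_CnM b) pi_CnV.
rewrite pi_CnP; split.
  move=> [/lenz_belowD h _] w v /h[u] /Dn_mulP[t] /Dn_domP[_ ->] bt.
  by exists u.
move=> h; split; apply/lenz_belowD => w v.
  move=> aw; have [u bu] := h _ _ aw; exists u.
  apply/Dn_mulP; exists (w ++ u) => //; apply/Dn_domP; split=> //.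
  by exists (v ++ u); apply: D_mor.
move=> /Dn_mulP[t] /Dn_domP[[v' aw] ->] bw.
have [u bu] := h _ _ aw; exists u.
by have := D_mor u aw; rewrite -bu (D_mor u bw).
Qed.

Lemma idemC a : idem (pi_Cn a) -> forall w v, a w = Some v -> v = w.
Proof.
rewrite /idem -pi_CnM => /pi_CnP[_ /lenz_belowD h] w v aw.
have [u /Dn_mulP[t]] := h _ _ aw.
rewrite (D_mor u aw) => -[<-] avu.
have E := D_inj avu (D_mor u aw).
have sz : size v = size w.
  by have /eqP := congr1 size E; rewrite !size_cat eqn_add2r => /eqP.
by move/eqP: E; rewrite eqseq_cat // => /andP[/eqP].
Qed.

Definition punion (f g : pfun) : pfun := fun w => if f w is Some v then Some v else g w.

Section Union.
Variables a b : Dn.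
Hypothesis ab : compatible (pi_Cn a) (pi_Cn b).

Let ab_fun w u v : a w = Some u -> b w = Some v -> u = v.
Proof.
move=> aw bw; have /idemC h : idem (pi_Cn (a * b^-1)).
  by rewrite pi_CnM pi_CnV; case: ab.
by apply: h; apply/Dn_mulP; exists w => //; apply/Dn_invP.
Qed.

Let ab_inj v w u : a v = Some u -> b w = Some u -> v = w.
Proof.
move=> av bw; have /idemC h : idem (pi_Cn (a^-1 * b)).
  by rewrite pi_CnM pi_CnV; case: ab.
by apply: h; apply/Dn_mulP; exists u => //; apply/Dn_invP.
Qed.

Lemma punionP w v : punion a b w = Some v <-> a w = Some v \/ b w = Some v.
Proof.
rewrite /punion; case aw: (a w) => [u|]; split; try by [left|right|case].
by move=> [//|bw]; rewrite (ab_fun aw bw).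
Qed.

Lemma bij_punion : bij_morphism (punion a b).
Proof.
have [da ca _ _] := dbij a; have [db cb _ _] := dbij b.
split.
- have -> : pdom (punion a b) = pdom a `|` pdom b.
    apply/seteqP; split=> [w [v /punionP[]]|w [[v h]|[v h]]].
    + by left; exists v.
    + by right; exists v.
    + by exists v; apply/punionP; left.
    + by exists v; apply/punionP; right.
  exact: fg_idealU.
- have -> : pcod (punion a b) = pcod a `|` pcod b.
    apply/seteqP; split=> [w [v /punionP[]]|w [[v h]|[v h]]].
    + by left; exists v.
    + by right; exists v.
    + by exists v; apply/punionP; left.
    + by exists v; apply/punionP; right.
  exact: fg_idealU.
- move=> v w u /punionP[h1|h1] /punionP[h2|h2].
  + exact: D_inj h1 h2.
  + exact: ab_inj h1 h2.
  + exact/esym/(ab_inj h2 h1).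
  + exact: D_inj h1 h2.
- move=> r r' s /punionP[] h; apply/punionP; [left|right]; exact: D_mor.
Qed.

Definition Dunion : Dn := MkDn (asboolT bij_punion).

Lemma Dunion_join : is_join [set pi_Cn a; pi_Cn b] (pi_Cn Dunion).
Proof.
split=> [_ [->|->]|].
- by apply/natleC => w v h; exists [::]; rewrite !cats0; apply/punionP; left.
- by apply/natleC => w v h; exists [::]; rewrite !cats0; apply/punionP; right.
- elim/pi_Cn_ind => d h; apply/natleC => w v /punionP[] hw.
    by have /natleC/(_ _ _ hw) : natle (pi_Cn a) (pi_Cn d) by apply: h; left.
  by have /natleC/(_ _ _ hw) : natle (pi_Cn b) (pi_Cn d) by apply: h; right.
Qed.

End Union.

Fact Cn_join (x y : Cn) : compatible x y -> exists z, is_join [set x; y] z.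
Proof.
elim/pi_Cn_ind: x => a; elim/pi_Cn_ind: y => b ab.
by exists (pi_Cn (Dunion ab)); apply: Dunion_join.
Qed.

Fact Cn_joinr (x y z s : Cn) : compatible x y -> is_join [set x; y] z ->
  is_join [set s * x; s * y] (s * z).
Proof.
elim/pi_Cn_ind: x => a; elim/pi_Cn_ind: y => b ab jz.
rewrite -(is_join_uniq (Dunion_join ab) jz).
elim/pi_Cn_ind: s => s; split=> [_ [->|->]|].
- apply: natleM; first exact: natle_refl.
  by apply: (Dunion_join ab).1; left.
- apply: natleM; first exact: natle_refl.
  by apply: (Dunion_join ab).1; right.
- elim/pi_Cn_ind => d; rewrite -(pi_CnM s (Dunion ab)) => h; apply/natleC => w v /Dn_mulP[u /punionP-[//|hw|hw] su].
    have /natleC : natle (pi_Cn (s * a)) (pi_Cn d) by rewrite pi_CnM; apply: h; left.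
    by apply; apply/Dn_mulP; exists u.
  have /natleC : natle (pi_Cn (s * b)) (pi_Cn d) by rewrite pi_CnM; apply: h; right.
  by apply; apply/Dn_mulP; exists u.
Qed.

Fact Cn_joinl (x y z s : Cn) : compatible x y -> is_join [set x; y] z ->
  is_join [set x * s; y * s] (z * s).
Proof.
elim/pi_Cn_ind: x => a; elim/pi_Cn_ind: y => b ab jz.
rewrite -(is_join_uniq (Dunion_join ab) jz).
elim/pi_Cn_ind: s => s; split=> [_ [->|->]|].
- apply: natleM; last exact: natle_refl.
  by apply: (Dunion_join ab).1; left.
- apply: natleM; last exact: natle_refl.
  by apply: (Dunion_join ab).1; right.
- elim/pi_Cn_ind => d; rewrite -(pi_CnM (Dunion ab) s) => h; apply/natleC => w v /Dn_mulP[u su /punionP-[//|hw|hw]].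
    have /natleC : natle (pi_Cn (a * s)) (pi_Cn d) by rewrite pi_CnM; apply: h; left.
    by apply; apply/Dn_mulP; exists u.
  have /natleC : natle (pi_Cn (b * s)) (pi_Cn d) by rewrite pi_CnM; apply: h; right.
  by apply; apply/Dn_mulP; exists u.
Qed.

HB.instance Definition _ :=
  InverseMonoid_isDistributive.Build Cn Cn_join Cn_joinr Cn_joinl.

Fact Cn_complemented : complemented (pi_Cn 0).
Proof.
split.
- by rewrite /idem -pi_CnM mulg0.
- by elim/pi_Cn_ind => a _; apply/natleC.
elim/pi_Cn_ind => a aa.
have aE := idemC aa.
have [[X XE] _ _ _] := dbij a.
have aX w : right_ideal X w <-> a w = Some w.
  have h : pdom a w <-> right_ideal X w by rewrite XE.
  split=> [/h[v av]|aw]; first by rewrite -{2}(aE _ _ av).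
  by apply/h; exists w.
pose N := \max_(x <- X) size x.
have XN x : x \in X -> (size x <= N)%N by move=> xX; apply: leq_bigmax_seq.
pose W := [seq tval t | t <- enum {: N.-tuple 'I_n}].
have WP t : t \in W <-> size t = N.
  split=> [/mapP[s _ ->]|st]; first by rewrite size_tuple.
  have stN : size t == N by apply/eqP.
  by apply/mapP; exists (Tuple stN); rewrite ?mem_enum.
pose Z := [seq t <- W | ~~ `[< right_ideal X t >]].
have ZP t : t \in Z <-> size t = N /\ ~ right_ideal X t.
  rewrite mem_filter; split=> [/andP[/asboolPn nt /WP]|[/WP tW nt]] //.
  by rewrite tW andbT; apply/asboolPn.
exists (pi_Cn (Didon Z)); split.
- rewrite /idem -pi_CnM; congr pi_Cn; apply: DnP => w v; split.
    by move=> /Dn_mulP[u /pidonP[_ ->]].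
  move=> /[dup] h /pidonP[_ vE]; apply/Dn_mulP.
  by exists w; rewrite -?vE in h *.
- rewrite -pi_CnM; congr pi_Cn; apply: DnP => w v; split=> //.
  move=> /Dn_mulP[u /pidonP[[t /ZP[tN nt] [s wE]] ->]].
  move=> /[dup] /aE -> /aX[x xX [r wE']].
  have [[q qE]|[q qE]] : (exists y, t = x ++ y) \/ (exists y, x = t ++ y).
  - by apply: (@cat_prefix _ _ r s); rewrite -wE -wE'.
  - by case: nt; exists x => //; exists q.
  - have := XN _ xX; rewrite qE size_cat tN -[leqRHS]addn0 leq_add2l leqn0 size_eq0.
    by move=> /eqP q0; case: nt; exists x => //; exists [::]; rewrite qE q0 !cats0.
- split=> [_ [->|->]|]; [by apply/natle1|apply/natleC => w v /pidonP[_ ->]|].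
    by exists [::]; rewrite cats0.
  elim/pi_Cn_ind => d h; apply/natleC => w _ [<-].
  have [u uN] : exists u : word, (N <= size (w ++ u))%N.
    case: (pselect (exists i : 'I_n, True)) => [[i _]|ni].
      by exists (nseq N i); rewrite size_cat size_nseq leq_addl.
    exists [::]; suff -> : N = 0%N by [].
    apply/eqP; rewrite -leqn0; apply/bigmax_leqP_seq => -[|i x] // _ _.
    by case: ni; exists i.
  have key : exists u', d (w ++ u ++ u') = Some (w ++ u ++ u').
    case: (pselect (right_ideal X (w ++ u))) => [/aX au|nu].
      have /natleC/(_ _ _ au)[u' du] : natle (pi_Cn a) (pi_Cn d) by apply: h; left.
      by exists u'; rewrite !catA.
    have ZU : Didon Z (w ++ u) = Some (w ++ u).
      apply/pidonP; split=> //; exists (take N (w ++ u)).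
        apply/ZP; split; first by rewrite size_takel.
        move=> [x xX [r E]]; apply: nu; exists x => //.
        by exists (r ++ drop N (w ++ u)); rewrite catA -E cat_take_drop.
      by exists (drop N (w ++ u)); rewrite cat_take_drop.
    have /natleC/(_ _ _ ZU)[u' du] : natle (pi_Cn (Didon Z)) (pi_Cn d) by apply: h; right.
    by exists u'; rewrite !catA.
  by have [u' du] := key; exists (u ++ u').
Qed.

HB.instance Definition _ := DistrInverseMonoid_isBoolean.Build Cn
  (complemented_boolean Cn_complemented).

Definition embC (p : Pn) : Cn := pi_Cn p.

End FreeMonoid.

(* Main.v *)
(** The hypothesis on [theta] refines [theta (x y^-1)] into the join of the
    [theta (xu (yu)^-1)] over all words [u] of a given length.  Domains of elements
    of [D_n] are finitely generated right ideals, so a finite family that is dense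
    below [x y^-1] contains all these pieces once [u] is long enough; hence [theta]
    turns covers into joins.  The same argument shows that the join of
    [{theta p | p in P_n, p <= a}], which exists because finitely many [p] are
    cofinal in this set, depends only on the Lenz class of [a] in [D_n].  It defines
    [psi [a]], and it is forced because [[a]] is itself the join in [C_n] of the
    [[p]] with [p <= a]. *)

Require Import Defs.
From HB Require Import structures.
From mathcomp Require Import all_boot.
From mathcomp Require Import boolp classical_sets.

Set Implicit Arguments.
Unset Strict Implicit.
Unset Printing Implicit Defensive.

Import Monoid Algebra.
Local Open Scope classical_set_scope.
Local Open Scope group_scope.

(** * Finite compatible joins and the maps that preserve them *)

Section Compatible.
Variable S : inverseMonoidType.
Implicit Types a b c : S.

Lemma natle_compatible a b c : natle a c -> natle b c -> compatible a b.
Proof.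
move=> ac bc; split; apply/natle1.
  apply: natle_trans (natleM (natleV ac) bc) _; exact/natle1/idem_dom.
apply: natle_trans (natleM ac (natleV bc)) _; exact/natle1/idem_ran.
Qed.

End Compatible.

Section Morphism.
Variables (S T : inverseMonoidType) (f : S -> T).
Hypothesis fM : {morph f : x y / x * y}.

Lemma morphV x : f x^-1 = (f x)^-1.
Proof. by apply: invg_uniq; rewrite -!fM ?mulgVKg ?mulVgKV. Qed.

Lemma morph_natle x y : natle x y -> natle (f x) (f y).
Proof. by move=> xy; rewrite /natle -morphV -!fM -xy. Qed.

Lemma morph_compatible x y : compatible x y -> compatible (f x) (f y).
Proof. by move=> [xy yx]; split; rewrite /idem -morphV -!fM ?xy ?yx. Qed.

End Morphism.

Section Joins.
Variable S : distrInverseMonoidType.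
Implicit Types a b c d : S.

Definition join_preserving (T : inverseMonoidType) (f : S -> T) :=
  forall a b c, compatible a b -> is_join [set a; b] c ->
    is_join [set f a; f b] (f c).

(** Idempotents are the elements below [1], and multiplication by [a^-1] distributes over the join.
    The second condition is reached through [d * a^-1], the inverse of [a * d^-1]. *)
Lemma compatible_joinr a b c d : compatible a b -> compatible a c ->
  compatible b c -> is_join [set b; c] d -> compatible a d.
Proof.
move=> [ab ba] [ac ca] bc jd; split; apply/natle1.
  apply: (mulg_joinr _ _ _ a^-1 bc jd).2 => _ [->|->]; exact/natle1.
rewrite -(idem_inv (idem1 S)) -[a * _]invgK; apply: natleV.
rewrite invgM invgK; apply: (mulg_joinl _ _ _ a^-1 bc jd).2 => _ [->|->].
  by apply/natle1; rewrite -[b]invgK -invgM (idem_inv ba).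
by apply/natle1; rewrite -[c]invgK -invgM (idem_inv ca).
Qed.

(** Induction on the list. The second clause makes the head compatible with the join of the tail, so
    binary joins suffice; the third holds because [f] preserves each binary join formed on the
    way. *)
Lemma join_seq x (l : seq S) :
  {in x :: l &, forall a b, compatible a b} ->
  exists c, [/\ is_join [set` x :: l] c,
    forall a, {in x :: l, forall b, compatible a b} -> compatible a c &
    forall (T : inverseMonoidType) (f : S -> T), join_preserving f ->
      is_join (f @` [set` x :: l]) (f c)].
Proof.
elim: l x => [|y l IH] x cxl.
  exists x; split=> [|a h|T f fj].
  - split=> [a /=|d h]; last by apply: h => /=; rewrite inE.
    by rewrite inE => /eqP ->; apply: natle_refl.
  - by apply: h; rewrite inE.
  - split=> [_ [a /= + <-]|d h]; last by apply: h; exists x => //=; rewrite inE.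
    by rewrite inE => /eqP ->; apply: natle_refl.
have [|c [jc cc fc]] := IH y.
  by move=> a b al bl; apply: cxl; rewrite inE ?al ?bl orbT.
have xc : compatible x c.
  by apply: cc => b bl; apply: cxl; rewrite inE ?eqxx ?bl ?orbT.
have [d jd] := compatible_join _ _ xc.
exists d; split=> [|a h|T f fj].
- split=> [a /=|e h].
    rewrite inE => /predU1P[->|al]; first by apply: jd.1; left.
    by apply: natle_trans (jc.1 _ al) _; apply: jd.1; right.
  apply: jd.2 => _ [->|->]; first by apply: h; rewrite /= inE eqxx.
  by apply: jc.2 => a al; apply: h; rewrite /= inE al orbT.
- apply: compatible_joinr xc jd; first by apply: h; rewrite inE eqxx.
  by apply: cc => b bl; apply: h; rewrite inE bl orbT.
- have [fd1 fd2] := fj _ _ _ xc jd; have [fc1 fc2] := fc _ _ fj.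
  split=> [_ [a /= + <-]|e h].
    rewrite inE => /predU1P[->|al]; first by apply: fd1; left.
    by apply: (natle_trans (fc1 _ _)); [exists a | apply: fd1; right].
  apply: fd2 => _ [->|->]; first by apply: h; exists x; rewrite //= inE eqxx.
  by apply: fc2 => _ [a /= al <-]; apply: h; exists a; rewrite //= inE al orbT.
Qed.

Lemma join_preserving_natle (T : inverseMonoidType) (f : S -> T) a b :
  join_preserving f -> natle a b -> natle (f a) (f b).
Proof.
move=> fj ab; have [] := fj _ _ b (natle_compatible ab (natle_refl b)) _; last first.
  by move=> h _; apply: h; left.
by split=> [_ [->|->]|d]; [| exact: natle_refl | apply; right].
Qed.

Lemma join_preservingM (s t : S) : join_preserving (fun x => s * x * t).
Proof.
move=> a b c ab jc; have sj := mulg_joinr _ _ _ s ab jc.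
apply: (mulg_joinl _ _ _ t _ sj).
by apply: (natle_compatible (c := s * c)); apply: sj.1; [left|right].
Qed.

Lemma join_seq_preserved x (l : seq S) c (T : inverseMonoidType) (f : S -> T) :
  {in x :: l &, forall a b, compatible a b} -> is_join [set` x :: l] c ->
  join_preserving f -> is_join (f @` [set` x :: l]) (f c).
Proof.
move=> cxl jc fj; have [c' [jc' _ h]] := join_seq cxl.
by rewrite (is_join_uniq jc jc'); apply: h.
Qed.

End Joins.


(** * Elements of the polycyclic monoid inside [Dn] *)

Section Polycyclic.
Variable n : nat.
Implicit Types (a b : Dn n) (p q : Pn n) (u v w x y : word n).

Lemma Pn_cases p : p = zerog \/ exists x y, p = Pmono x y.
Proof.
have /asboolP[h|[x [y h]]] := pn_valP p; [left|right; exists x, y];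
  exact: val_inj.
Qed.

Lemma natle_Pn p q : natle p q <-> natle (p : Dn n) q.
Proof. by split=> [h|h]; [rewrite /natle {1}h | apply: val_inj]. Qed.

Lemma compatible_Pn p q : compatible (p : Dn n) q -> compatible p q.
Proof. by move=> [h1 h2]; split; apply: val_inj. Qed.

Lemma natle_Dmono v w a : natle (Dmono v w) a <-> a w = Some v.
Proof.
split=> [/natleD|aw]; last first.
  by apply/natleD => _ _ /pmonoP[u -> ->]; apply: D_mor.
by apply; apply/pmonoP; exists [::]; rewrite cats0.
Qed.

Lemma PmonoM x y u : Pmono x y * Pmono y u = Pmono x u.
Proof.
apply/val_inj/DnP => w v; split=> [/Dn_mulP[s]|].
  move=> /pmonoP[t -> ->] /pmonoP[t' /eqP]; rewrite eqseq_cat // eqxx /=.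
  by move=> /eqP <- ->; apply/pmonoP; exists t.
move=> /pmonoP[t -> ->]; apply/Dn_mulP; exists (y ++ t); apply/pmonoP;
  by exists t.
Qed.

Lemma Pmono_cat x y u :
  Pmono (x ++ u) (y ++ u) = Pmono x [::] * Pmono u u * Pmono [::] y.
Proof.
apply/val_inj/DnP => w v; split.
  move=> /pmonoP[t -> ->]; apply/Dn_mulP; exists (u ++ t).
    by apply/pmonoP; exists (u ++ t); rewrite ?catA.
  apply/Dn_mulP; exists (u ++ t); apply/pmonoP; first by exists t.
  by exists (u ++ t); rewrite ?catA.
move=> /Dn_mulP[_ /pmonoP[t -> ->] /Dn_mulP[_ /pmonoP[t' /= -> ->]]].
by move=> /pmonoP[_ /= <- ->]; apply/pmonoP; exists t'; rewrite catA.
Qed.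

(* Membership in a finitely generated right ideal is decided by a prefix of bounded
   length: if [b] is defined on some extension of a long [w], then already on [w]. *)
Lemma dom_bounded (l : seq (Dn n)) : exists N, forall b, b \in l ->
  forall w u v, (N <= size w)%N -> b (w ++ u) = Some (v ++ u) -> b w = Some v.
Proof.
elim: l => [|b l [N IH]]; first by exists 0%N.
have [[X XE] _ _ _] := dbij b.
exists (maxn N (\max_(x <- X) size x)) => c.
rewrite inE => /predU1P[->|cl] w u v; rewrite geq_max => /andP[Nw Xw] cw;
  last exact: IH cw.
have : pdom b (w ++ u) by exists (v ++ u).
rewrite XE => -[x xX [t E]].
have [s wE] : exists s, w = x ++ s.
  have [[s sE]|[s sE]] := cat_prefix E; last by exists s.
  have : (size x <= \max_(x <- X) size x)%N by apply: leq_bigmax_seq.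
  rewrite sE size_cat => /leq_trans/(_ Xw).
  rewrite -[leqRHS]addn0 leq_add2l leqn0 size_eq0 => /eqP ->.
  by exists [::]; rewrite !cats0.
have [v' bw] : pdom b w by rewrite XE; exists x => //; exists s.
move: cw; rewrite (D_mor u bw) bw => -[E'].
have sz : size v' = size v.
  by have /eqP := congr1 size E'; rewrite !size_cat eqn_add2r => /eqP.
by move/eqP: E'; rewrite eqseq_cat // => /andP[/eqP ->].
Qed.

End Polycyclic.

(** * The join of the images of the polycyclic elements below [a] *)

Section Below.
Variables (n : nat) (B : distrInverseMonoidType) (theta : Pn n -> B).
Hypothesis thetaM : {morph theta : p q / p * q}.
Implicit Types (a b : Dn n) (p q : Pn n) (t v w : word n).

Definition below a : set B :=
  [set theta p | p in [set p : Pn n | natle (p : Dn n) a]].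

(** For the generators [x] of the domain of [a], the elements [a(x) x^-1] are cofinal: if [v w^-1]
    is below [a], then [w] extends some [x]. Adding [zerog] covers [q = 0] and keeps the list
    nonempty. *)
Lemma below_cofinal a : exists l : seq (Pn n),
  (forall p, p \in zerog :: l -> natle (p : Dn n) a) /\
  (forall q, natle (q : Dn n) a -> exists2 p, p \in zerog :: l & natle q p).
Proof.
have [[X XE] _ _ _] := dbij a.
exists (pmap (fun x => omap (fun v => Pmono v x) (a x)) X); split=> [p|q qa].
  rewrite inE mem_pmap => /predU1P[->|/mapP[x xX]]; first by apply/natleD.
  by case ax: (a x) => [v|] //= [->]; apply/natle_Dmono.
have [->|[v [w qE]]] := Pn_cases q.
  by exists zerog; [rewrite inE eqxx | apply: natle_refl].
move: qa; rewrite qE => /natle_Dmono aw.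
have : pdom a w by exists v.
rewrite XE => -[x xX [t wE]].
have [v' ax] : pdom a x by rewrite XE; exists x => //; exists [::]; rewrite cats0.
exists (Pmono v' x).
  rewrite inE mem_pmap; apply/orP; right; apply/mapP; exists x => //.
  by rewrite ax.
apply/natle_Pn/natle_Dmono/pmonoP; exists t => //.
by move: aw; rewrite wE (D_mor t ax) => -[].
Qed.

(** The join over the finite cofinal list serves for the whole set. Quantifying over [f] gives
    preservation and, with [f] the identity, existence. *)
Lemma join_below a : exists c, forall (T : inverseMonoidType) (f : B -> T),
  join_preserving f -> is_join (f @` below a) (f c).
Proof.
have [l [la acof]] := below_cofinal a.
have lP e : e \in theta zerog :: map theta l ->
    exists2 p, p \in zerog :: l & e = theta p.
  by rewrite -[_ :: _]/(map theta (zerog :: l)) => /mapP.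
have cl : {in theta zerog :: map theta l &, forall e1 e2, compatible e1 e2}.
  move=> e1 e2 /lP[p pl ->] /lP[q ql ->]; apply: (morph_compatible thetaM).
  by apply: compatible_Pn; apply: natle_compatible (la _ pl) (la _ ql).
have [c [jc _ fc]] := join_seq cl.
exists c => T f fj; have [f1 f2] := fc _ _ fj; split.
  move=> _ [_ [p pa <-] <-]; have [q ql pq] := acof _ pa.
  apply: (@natle_trans _ (f (theta q))).
    exact/(join_preserving_natle fj)/(morph_natle thetaM).
  by apply: f1; exists (theta q) => //=; apply: (map_f theta ql).
move=> d h; apply: f2 => _ [_ /= /lP[p pl ->] <-]; apply: h.
by exists (theta p) => //; exists p => //; apply: la.
Qed.

Lemma join_below_preserved a c (T : inverseMonoidType) (f : B -> T) :
  is_join (below a) c -> join_preserving f -> is_join (f @` below a) (f c).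
Proof.
have [c' jc'] := join_below a => jc; have := jc' B id (fun _ _ _ _ h => h).
by rewrite image_id => /(is_join_uniq jc) ->; apply: jc'.
Qed.

Lemma join_below_exists a : exists c, is_join (below a) c.
Proof.
have [c jc] := join_below a; exists c.
by have := jc B id (fun _ _ _ _ h => h); rewrite image_id.
Qed.

End Below.

(** * Covers become joins, and [theta] extends to [Cn] *)

Section Extension.
Variables (n : nat) (B : booleanInverseMonoidType) (theta : Pn n -> B).
Hypothesis n_gt0 : (0 < n)%N.
Hypothesis theta_morph : monoid_morphism theta.
Hypothesis theta_join :
  is_join (range (fun i : 'I_n => theta (Pmono [:: i] [:: i]))) 1.
Implicit Types (a b : Dn n) (p q : Pn n) (u v w x y : word n) (d : B).

Let thetaM : {morph theta : p q / p * q}. Proof. exact: theta_morph.2. Qed.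

(** Multiplying the join [1] of the [theta (a_i a_i^-1)] by the images of [x] on the left and [y^-1]
    on the right presents [theta (x y^-1)] as the join of the [theta (x a_i (y a_i)^-1)]. *)
Lemma theta_letters x y d :
  (forall i, natle (theta (Pmono (x ++ [:: i]) (y ++ [:: i]))) d) ->
  natle (theta (Pmono x y)) d.
Proof.
move=> h; pose f i := theta (Pmono [:: i] [:: i]).
(* Finite joins are set up for nonempty lists; [n_gt0] supplies the head. *)
have [i0 [l iE]] : {i0 & {l | enum 'I_n = i0 :: l}}.
  case E : (enum 'I_n) => [|i l]; last by exists i, l.
  by have := size_enum_ord n; rewrite E => /esym n0; move: n_gt0; rewrite n0.
have fl i : f i \in f i0 :: map f l.
  by rewrite -[_ :: _]/(map f (i0 :: l)) -iE map_f ?mem_enum.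
have lf e : e \in f i0 :: map f l -> exists i, e = f i.
  by rewrite -[_ :: _]/(map f (i0 :: l)) => /mapP[i _ ->]; exists i.
have fle1 e : e \in f i0 :: map f l -> natle e 1.
  by move=> /lf[i ->]; apply: theta_join.1; exists i.
have j1 : is_join [set` f i0 :: map f l] 1.
  split=> [e /fle1 //|c hc]; apply: theta_join.2 => _ [i _ <-].
  exact/hc/fl.
have cl : {in f i0 :: map f l &, forall e1 e2, compatible e1 e2}.
  by move=> e1 e2 /fle1 le1 /fle1; apply: natle_compatible.
have [_ jl] := join_seq_preserved cl j1
  (join_preservingM (theta (Pmono x [::])) (theta (Pmono [::] y))).
rewrite mulg1 -thetaM PmonoM in jl; apply: jl => _ [_ /lf[i ->] <-].
by rewrite -!thetaM -Pmono_cat.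
Qed.

Lemma theta_refine N x y d :
  (forall u, size u = N -> natle (theta (Pmono (x ++ u) (y ++ u))) d) ->
  natle (theta (Pmono x y)) d.
Proof.
elim: N x y => [|N IH] x y h.
  by have := h [::] erefl; rewrite !cats0.
apply: theta_letters => i; apply: IH => u uN.
by rewrite -!catA; apply: h; rewrite /= uN.
Qed.

(** Refine to words [u] of the length [N] given by [dom_bounded]. Some [b] in [l] agrees with
    [x y^-1] on an extension of [y ++ u], hence already on [y ++ u], so [xu (yu)^-1] is below
    [b]. *)
Lemma theta_dense x y (l : seq (Dn n)) d :
  (forall u, exists2 b, b \in l &
     exists u', b (y ++ u ++ u') = Some (x ++ u ++ u')) ->
  (forall b, b \in l -> forall q, natle (q : Dn n) b -> natle (theta q) d) ->
  natle (theta (Pmono x y)) d.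
Proof.
move=> dense ub; have [N bN] := dom_bounded l.
apply: (@theta_refine N) => u uN; have [b bl [u' bu]] := dense u.
apply: (ub b bl); apply/natle_Dmono; apply: (bN b bl _ u').
  by rewrite size_cat uN leq_addl.
by rewrite -!catA.
Qed.

Lemma theta_natle p q : natle p q -> natle (theta p) (theta q).
Proof. exact: morph_natle. Qed.

(** The cover condition, applied to each [xu (yu)^-1], gives a nonzero [s t^-1] below it and below
    some [c i]; then [t] extends [y ++ u], which is the density needed. *)
Lemma theta_cover_to_join : cover_to_join theta.
Proof.
move=> a m c [m_gt0 ca cov]; split=> [_ [i _ <-]|d h].
  exact/theta_natle/ca.
have [a0|[x [y aE]]] := Pn_cases a.
  (* When [a = 0] every [c i] is [0], so [theta a] itself belongs to the family. *)
  have := ca (Ordinal m_gt0); rewrite a0 => /natle0 <-.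
  by apply: h; exists (Ordinal m_gt0).
rewrite aE; apply: (@theta_dense _ _ [seq (c i : Dn n) | i <- enum 'I_m]).
  move=> u; have xa : natle (Pmono (x ++ u) (y ++ u)) a.
    rewrite aE; apply/natle_Pn/natle_Dmono/pmonoP; by exists u.
  have [|i [z [zx zc _] z0]] := cov _ _ xa.
    move=> /(congr1 (fun p : Pn n => p (y ++ u))).
    by have /= -> := (natle_Dmono _ _ _).1 (natle_refl (Dmono (x ++ u) (y ++ u))).
  exists (pn_val (c i)); first by apply/mapP; exists i; rewrite ?mem_enum.
  have [//|[s [t zE]]] := Pn_cases z.
  have zt : z t = Some s by rewrite zE; exact/natle_Dmono/natle_refl.
  move/natle_Pn/natleD/(_ _ _ zt) : zx => /pmonoP[u' tE sE].
  by exists u'; rewrite !catA -tE -sE; move/natle_Pn/natleD: zc; apply.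
move=> b /mapP[i _ ->] q /natle_Pn/theta_natle qc.
by apply: natle_trans qc _; apply: h; exists i.
Qed.

(** By [natleC], [b] agrees with [a] on an extension of every word in the domain of [a]; this is
    density for the one-element list [b]. It yields both independence of the representative and
    monotonicity of [ext]. *)
Lemma ub_below_natleC a b d : natle (pi_Cn a) (pi_Cn b) ->
  (forall e, below theta b e -> natle e d) ->
  forall e, below theta a e -> natle e d.
Proof.
move=> /natleC ab ub _ [p pa <-].
have [->|[v [w pE]]] := Pn_cases p.
  by apply: ub; exists zerog => //; apply/natleD.
move: pa; rewrite pE => /= /natle_Dmono aw.
apply: (@theta_dense v w [:: b]) => [u|_ /predU1P[->|//] q qb].
  exists b; rewrite ?inE //.
  have [u' bu] := ab _ _ (D_mor u aw).
  by exists u'; rewrite !catA.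
by apply: ub; exists q.
Qed.

Definition ext (x : Cn n) : B :=
  projT1 (cid (join_below_exists thetaM (repr (x : lenz_quot (Dn n))))).

(** The chosen representative and [a] have the same class, so their sets [below] have the same upper
    bounds. *)
Lemma extP a : is_join (below theta a) (ext (pi_Cn a)).
Proof.
rewrite /ext; case: cid => c /= [c1 c2].
set b := repr _ in c1 c2; have ab : pi_Cn b = pi_Cn a by apply/pi_CnP/lenz_repr.
split; first by apply: (@ub_below_natleC _ b); rewrite // ab; apply: natle_refl.
move=> d h; apply: c2; apply: ub_below_natleC h.
by rewrite ab; apply: natle_refl.
Qed.

Lemma ext_natle a b : natle (pi_Cn a) (pi_Cn b) ->
  natle (ext (pi_Cn a)) (ext (pi_Cn b)).
Proof.
by move=> ab; apply: (extP a).2; apply: ub_below_natleC ab (extP b).1.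
Qed.

Lemma ext_embC p : ext (embC p) = theta p.
Proof.
apply: is_join_uniq (extP p) _; split=> [_ [q /natle_Pn/theta_natle qp <-] //|d].
by apply; exists p => //; apply: natle_refl.
Qed.

(** Upwards, [v w^-1] below [a * b] factors as [(v u^-1)(u w^-1)] with [u = b(w)]. Downwards, the
    product distributes over both joins, leaving [theta (p * q)] with [p * q] below [a * b]. *)
Lemma extM : {morph ext : x y / x * y}.
Proof.
elim/pi_Cn_ind=> a; elim/pi_Cn_ind=> b; rewrite -pi_CnM.
apply: natle_anti.
  apply: (extP (a * b)).2 => _ [p /= pab <-].
  have [->|[v [w pE]]] := Pn_cases p.
    rewrite -(mulg0 zerog) thetaM.
    by apply: natleM; apply: (extP _).1; exists zerog => //; apply/natleD.
  move: pab; rewrite pE => /natle_Dmono/Dn_mulP[u bw au].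
  rewrite -(PmonoM v u w) thetaM.
  by apply: natleM; apply: (extP _).1; eexists => //; apply/natle_Dmono.
(* Distributivity, used first to expand the left factor and then the right one. *)
have jM c s t := join_below_preserved thetaM (extP c) (join_preservingM s t).
have [_ ja] := jM a 1 (ext (pi_Cn b)); rewrite mul1g in ja; apply: ja.
move=> _ [_ [p pa <-] <-]; rewrite mul1g.
have [_ jb] := jM b (theta p) 1; rewrite mulg1 in jb; apply: jb.
move=> _ [_ [q qb <-] <-]; rewrite mulg1 -thetaM.
by apply: (extP _).1; exists (p * q) => //; apply: natleM.
Qed.

(** The join of two compatible classes is the class of the union. An element [v w^-1] below the
    union is below one of the two parts, since it is determined by the single value at [w]. *)
Lemma ext_morphism : boolean_morphism ext.
Proof.
split.
  split; last exact: extM.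
  by rewrite -[1]/(embC 1) ext_embC theta_morph.1.
elim/pi_Cn_ind=> a; elim/pi_Cn_ind=> b c ab /(is_join_uniq (Dunion_join ab)) <-.
have jc := Dunion_join ab.
split=> [_ [->|->]|d h].
- by apply: ext_natle; apply: jc.1; left.
- by apply: ext_natle; apply: jc.1; right.
have ha : natle (ext (pi_Cn a)) d by apply: h; left.
have hb : natle (ext (pi_Cn b)) d by apply: h; right.
apply: (extP _).2 => _ [p pab <-].
have [pa|pb] : natle (p : Dn n) a \/ natle (p : Dn n) b.
- have [->|[v [w pE]]] := Pn_cases p; first by left; apply/natleD.
  move: pab; rewrite pE => /natle_Dmono/punionP-/(_ ab)[] h'; [left|right];
    exact/natle_Dmono.
- by apply: natle_trans ha; apply: (extP a).1; exists p.
- by apply: natle_trans hb; apply: (extP b).1; exists p.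
Qed.

End Extension.

(** * Uniqueness of the extension *)

Lemma embCM n : {morph @embC n : p q / p * q}.
Proof. by move=> p q; apply: pi_CnM. Qed.

(** Being above the class of [v w^-1] for each [v = a(w)] is, word by word, the criterion [natleC]
    for being above the class of [a]. *)
Lemma join_below_embC n (a : Dn n) : is_join (below (@embC n) a) (pi_Cn a).
Proof.
split=> [_ [p /natleD pa <-]|].
  by apply/natleC => w v /pa aw; exists [::]; rewrite !cats0.
elim/pi_Cn_ind=> d h; apply/natleC => w v aw.
have /natleC : natle (embC (Pmono v w)) (pi_Cn d).
  by apply: h; exists (Pmono v w) => //; apply/natle_Dmono.
by apply; exact/natle_Dmono/natle_refl.
Qed.

Theorem theorem4p25 (n : nat) (n_ge2 : (2 <= n)%N)
    (B : booleanInverseMonoidType) (theta : Pn n -> B)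
    (theta_morph : monoid_morphism theta)
    (theta_join : is_join (range (fun i : 'I_n => theta (Pmono [:: i] [:: i]))) 1) :
  cover_to_join theta /\
  exists! psi : Cn n -> B, boolean_morphism psi /\ psi \o @embC n = theta.
Proof.
have n_gt0 := ltnW n_ge2; split; first exact: theta_cover_to_join.
exists (ext theta_morph); split.
  split; first exact: ext_morphism.
  by apply/funext => p; apply: ext_embC.
move=> phi [[_ phi_join] phiE]; apply/funext; elim/pi_Cn_ind=> a.
apply: is_join_uniq (extP n_gt0 theta_morph theta_join a) _.
(* [phi] preserves this join through its finite cofinal part, so [phi [a]] is the join of the same
   values [theta p] that defines [ext [a]]. *)
have := join_below_preserved (@embCM n) (join_below_embC a) phi_join.
by rewrite image_comp -phiE.
Qed.
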